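(* Let $K\subset\mathbb{R}^m$ be a compact set and let $g:K\to[0,1]$ be a continuous function. Then, for any $\epsilon>0$, there exists a function $f_{\mathrm{LHT}}:K\to[0,1]$ defined by a Learning Hyperplane Tree (LHT) such that $$\sup_{\mathbf{x}\in K}|f_{\mathrm{LHT}}(\mathbf{x})-g(\mathbf{x})|<\epsilon.$$
   Context: **Learning Hyperplane Tree (LHT).** An LHT is a finite binary tree built recursively from a finite set of samples in $\mathbb{R}^m$, each labelled as target ($p=1$) or non-target ($p=0$). Parameters are $\alpha\ge0$, $0\le\beta\le1$, $\gamma>0$ and a minimum sample count. The root holds all samples. A node is a leaf if its samples all have the same label or if it has too few samples (fewer than the minimum count). Otherwise it is a branching node, with a hyperplane computed from the node's samples as follows ($\mathbb{E}$ denotes a sample mean over the node's samples). *Weights.* Features $i$ with $\mathbb{E}[X_i^2]-(\mathbb{E}[X_i])^2>\alpha$ are retained. With $\mathbb{E}[X_i^{\mathrm{t}}]$, $\mathbb{E}[X_i^{\mathrm{nt}}]$ the means of feature $i$ over the node's target and non-target samples, put $\mathrm{SD}_i=\mathbb{E}[X_i^{\mathrm{t}}]-\mathbb{E}[X_i^{\mathrm{nt}}]$, $\overline{\mathrm{SD}}=\max_i|\mathrm{SD}_i|$, $w_i=\mathrm{SD}_i/\overline{\mathrm{SD}}$, and select features with $|w_i|\ge\beta$. The feature-weighted sum is $\mathrm{FS}(\mathbf{x})=\sum_i w_i x_i$ over the selected features. *Threshold.* Let $\min\mathrm{TFS},\max\mathrm{TFS}$ (resp. $\min\mathrm{NFS},\max\mathrm{NFS}$)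 be the minimum and maximum of $\mathrm{FS}$ over the node's target (resp. non-target) samples, and $e$ the average of these four numbers. Let $N_1$ (resp. $N_2$) be the number of target samples with $\mathrm{FS}<\min\mathrm{NFS}$ (resp. $\mathrm{FS}>\max\mathrm{NFS}$), $N_3$ (resp. $N_4$) the number of non-target samples with $\mathrm{FS}<\min\mathrm{TFS}$ (resp. $\mathrm{FS}>\max\mathrm{TFS}$), and $N_{\max}=\max\{N_1,N_2,N_3,N_4\}$. If $N_{\max}\ge\gamma$, then $c$ is $\min\mathrm{NFS}$, $\max\mathrm{NFS}+\delta_1$, $\min\mathrm{TFS}$ or $\max\mathrm{TFS}+\delta_1$ according to whether $N_1$, $N_2$, $N_3$ or $N_4$ equals $N_{\max}$, with $\delta_1>0$ infinitesimally small; if $N_{\max}<\gamma$, then $c=e$. *Routing.* A point $\mathbf{x}$ at the node goes to the left child if $\mathrm{FS}(\mathbf{x})-c<0$ and to the right child if $\mathrm{FS}(\mathbf{x})-c\ge0$. Each $\mathbf{x}$ thus reaches exactly one leaf; the set of points reaching a given leaf is its leaf region $R$. **LHT-defined function.** Each leaf region $R$ carries an affine function $L_R(\mathbf{x})=\mathbf{a}_R^{T}\mathbf{x}+b_R$ obtained by local least-squares fitting. In classification the fit is to the $0/1$ labels of the leaf's samples. For the approximation of $g$, a set of points $\{\mathbf{x}_i\}\subset R\cap K$ is selected and $L_R$ is fitted by least squares to approximate the values $g(\mathbf{x}_i)$. The function defined by the LHT is $$f_{\mathrm{LHT}}(\mathbf{x})=\max\{0,\min\{L_R(\mathbf{x}),1\}\}\quad\text{for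 }\mathbf{x}\in R\cap K.$$ *)

(* Defs.v *)
From HB Require Import structures.
From mathcomp Require Import all_boot all_order all_algebra.
From mathcomp Require Import finmap.
From mathcomp Require Import all_classical all_reals all_analysis.

Set Implicit Arguments.
Unset Strict Implicit.
Unset Printing Implicit Defensive.

Import Order.TTheory GRing.Theory Num.Theory.
Import numFieldNormedType.Exports.

Local Open Scope fset_scope.
Local Open Scope classical_set_scope.
Local Open Scope ring_scope.

Record lht_params (R : realType) := LhtParams {
  alpha : R;
  beta : R;
  gamma : R;
  min_count : nat;
  alpha_ge0 : 0 <= alpha;
  beta_itv : 0 <= beta <= 1;
  gamma_gt0 : 0 < gamma
}.

Definition fmean (R : realType) (T : choiceType) (A : {fset T}) (h : T -> R)
    : R :=
  (\sum_(x <- A) h x) / #|` A|%:R.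

(* The default value [head 0 s] is itself a value of [h] as soon as [A] is
   nonempty, so these are the actual minimum and maximum of [h] over [A];
   they are only used for nonempty [A]. *)
Definition fmin (R : realType) (T : choiceType) (A : {fset T}) (h : T -> R)
    : R :=
  let s := [seq h x | x <- A] in \big[Num.min/head 0 s]_(v <- s) v.
Definition fmax (R : realType) (T : choiceType) (A : {fset T}) (h : T -> R)
    : R :=
  let s := [seq h x | x <- A] in \big[Num.max/head 0 s]_(v <- s) v.

(* A data set is a finite set of points [X] with a labelling [p]
   ([true] = target, [false] = non-target); only the values of [p] on [X]
   matter. *)
Definition targets (R : realType) (m : nat) (p : 'rV[R]_m -> bool)
    (X : {fset 'rV[R]_m}) : {fset 'rV[R]_m} := [fset x in X | p x].
Definition nontargets (R : realType) (m : nat) (p : 'rV[R]_m -> bool)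
    (X : {fset 'rV[R]_m}) : {fset 'rV[R]_m} := [fset x in X | ~~ p x].

Definition retained (R : realType) (m : nat) (q : lht_params R)
    (X : {fset 'rV[R]_m}) (i : 'I_m) : bool :=
  alpha q < fmean X (fun x => x 0 i ^+ 2) - (fmean X (fun x => x 0 i)) ^+ 2.

Definition SD (R : realType) (m : nat) (p : 'rV[R]_m -> bool)
    (X : {fset 'rV[R]_m}) (i : 'I_m) : R :=
  fmean (targets p X) (fun x => x 0 i) - fmean (nontargets p X) (fun x => x 0 i).

(* The maximum ranges over the retained features. *)
Definition SDmax (R : realType) (m : nat) (q : lht_params R)
    (p : 'rV[R]_m -> bool) (X : {fset 'rV[R]_m}) : R :=
  \big[Num.max/0]_(i < m | retained q X i) `|SD p X i|.

Definition weight (R : realType) (m : nat) (q : lht_params R)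
    (p : 'rV[R]_m -> bool) (X : {fset 'rV[R]_m}) (i : 'I_m) : R :=
  SD p X i / SDmax q p X.

Definition selected (R : realType) (m : nat) (q : lht_params R)
    (p : 'rV[R]_m -> bool) (X : {fset 'rV[R]_m}) (i : 'I_m) : bool :=
  retained q X i && (beta q <= `|weight q p X i|).

Definition FS (R : realType) (m : nat) (q : lht_params R)
    (p : 'rV[R]_m -> bool) (X : {fset 'rV[R]_m}) (x : 'rV[R]_m) : R :=
  \sum_(i < m | selected q p X i) weight q p X i * x 0 i.

(* Thresholds are functions of the infinitesimal [delta1]: [c d] is the
   threshold when [delta1] has the value [d].  When several of the counts
   attain the maximum, each of the corresponding thresholds is admissible. *)
Definition is_threshold (R : realType) (m : nat) (q : lht_params R)
    (p : 'rV[R]_m -> bool) (X : {fset 'rV[R]_m}) (c : R -> R) : Prop :=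
  let fs := FS q p X in
  let T := targets p X in
  let N := nontargets p X in
  let minTFS := fmin T fs in
  let maxTFS := fmax T fs in
  let minNFS := fmin N fs in
  let maxNFS := fmax N fs in
  let e := (minTFS + maxTFS + minNFS + maxNFS) / 4 in
  let N1 := #|` [fset x in T | fs x < minNFS]| in
  let N2 := #|` [fset x in T | fs x > maxNFS]| in
  let N3 := #|` [fset x in N | fs x < minTFS]| in
  let N4 := #|` [fset x in N | fs x > maxTFS]| in
  let Nmax := maxn (maxn N1 N2) (maxn N3 N4) in
  if gamma q <= Nmax%:R then
    [\/ N1 = Nmax /\ c = (fun=> minNFS),
        N2 = Nmax /\ c = (fun d => maxNFS + d),
        N3 = Nmax /\ c = (fun=> minTFS) |
        N4 = Nmax /\ c = (fun d => maxTFS + d)]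
  else c = (fun=> e).

(* [delta1] being infinitesimally small, a sign condition on [fs x - c] is
   required to hold for all sufficiently small positive values of [delta1]. *)
Definition left_side (R : realType) (m : nat) (fs : 'rV[R]_m -> R) (c : R -> R)
    : set 'rV[R]_m :=
  [set x | \forall d \near 0^'+, fs x - c d < 0].
Definition right_side (R : realType) (m : nat) (fs : 'rV[R]_m -> R) (c : R -> R)
    : set 'rV[R]_m :=
  [set x | \forall d \near 0^'+, fs x - c d >= 0].

Inductive hyperplane_tree (R : realType) (m : nat) : Type :=
| Leaf
| Branch (fs : 'rV[R]_m -> R) (c : R -> R) (l r : hyperplane_tree R m).
Arguments Leaf {R m}.

Definition is_leaf_node (R : realType) (m : nat) (q : lht_params R)
    (p : 'rV[R]_m -> bool) (X : {fset 'rV[R]_m}) : bool :=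
  constant [seq p x | x <- X] || (#|` X| < min_count q)%N.

(* [is_LHT q p X t]: the samples [X] labelled by [p] produce the tree [t].
   The weights of a branching node are quotients by [SDmax], so a branching
   node is only allowed if [SDmax] is nonzero. *)
Inductive is_LHT (R : realType) (m : nat) (q : lht_params R)
    (p : 'rV[R]_m -> bool) : {fset 'rV[R]_m} -> hyperplane_tree R m -> Prop :=
| LHT_leaf X : is_leaf_node q p X -> is_LHT q p X Leaf
| LHT_branch X c l r :
    ~~ is_leaf_node q p X ->
    SDmax q p X != 0 ->
    is_threshold q p X c ->
    is_LHT q p [fset x in X | `[< left_side (FS q p X) c x >]] l ->
    is_LHT q p [fset x in X | `[< right_side (FS q p X) c x >]] r ->
    is_LHT q p X (Branch (FS q p X) c l r).

(* The leaf regions of [t] inside the region [D] of its root. *)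
Fixpoint leaf_regions (R : realType) (m : nat) (t : hyperplane_tree R m)
    (D : set 'rV[R]_m) : set (set 'rV[R]_m) :=
  match t with
  | Leaf => [set D]
  | Branch fs c l r =>
      leaf_regions l (D `&` left_side fs c) `|`
      leaf_regions r (D `&` right_side fs c)
  end.

Definition affine (R : realType) (m : nat) (a : 'rV[R]_m) (b : R)
    (x : 'rV[R]_m) : R :=
  \sum_(i < m) a 0 i * x 0 i + b.

Definition least_squares_fit (R : realType) (m : nat) (P : {fset 'rV[R]_m})
    (g : 'rV[R]_m -> R) (a : 'rV[R]_m) (b : R) : Prop :=
  forall (a' : 'rV[R]_m) (b' : R),
    \sum_(x <- P) (affine a b x - g x) ^+ 2 <=
    \sum_(x <- P) (affine a' b' x - g x) ^+ 2.

(* [f] is defined on [K] by a Learning Hyperplane Tree approximating [g].  The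
   affine functions are indexed by the leaf regions, which are pairwise
   disjoint; at least one point is selected in every region that meets [K]. *)
Definition LHT_defined (R : realType) (m : nat) (K : set 'rV[R]_m)
    (g f : 'rV[R]_m -> R) : Prop :=
  exists (q : lht_params R) (X : {fset 'rV[R]_m}) (p : 'rV[R]_m -> bool)
         (t : hyperplane_tree R m)
         (a : set 'rV[R]_m -> 'rV[R]_m) (b : set 'rV[R]_m -> R),
    is_LHT q p X t /\
    forall Q : set 'rV[R]_m, leaf_regions t setT Q ->
      (exists P : {fset 'rV[R]_m},
         [/\ [set` P] `<=` Q `&` K,
             (Q `&` K !=set0 -> P != fset0) &
             least_squares_fit P g (a Q) (b Q)]) /\
      (forall x, (Q `&` K) x ->
         f x = Num.max 0 (Num.min (affine (a Q) (b Q) x) 1)).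

(* Main.v *)
(** The samples are placed so that the tree is forced to be an axis-parallel
    bisection of a box around [K]. Each final cell of the bisection contains
    one non-target, at its centre [c], and one target, at [c + d] for a tiny
    displacement [d] depending on the cell. At any node the vector [SD] is then
    the mean of the displacements over the cells below it. Passing to the two
    halves of a node changes this mean by [+u] and [-u], with [u] along the next
    axis to be split and larger than the current mean, so that at every node
    [SD] is dominated by the coordinate along which we want to split. With
    [beta = 1] only that feature is selected; with [gamma] larger than all
    counts the threshold is the average [e] of the extrema, which lies near the
    middle of the box; with a minimum count of 3 the leaves are exactly the
    two-sample cells. Fitting [g] at a single point of each leaf region gives a
    constant, and uniform continuity of [g] concludes. *)

Require Import Defs.
From HB Require Import structures.
From mathcomp Require Import all_boot all_order all_algebra.
From mathcomp Require Import finmap.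
From mathcomp Require Import all_classical all_reals all_analysis.
From mathcomp Require Import ring lra.

Set Implicit Arguments.
Unset Strict Implicit.
Unset Printing Implicit Defensive.

Import Order.TTheory GRing.Theory Num.Theory.
Import numFieldNormedType.Exports.

Local Open Scope classical_set_scope.
Local Open Scope ring_scope.

(** * Disjointness of leaf regions *)

Lemma leaf_regions_sub (R : realType) (m : nat) (t : hyperplane_tree R m) D Q :
  leaf_regions t D Q -> Q `<=` D.
Proof.
elim: t D => [|fs c l IHl r IHr] D /=; first by move=> ->.
by case=> [/IHl|/IHr] QD x /QD[].
Qed.

(** The two sides of a branching are disjoint: conditions holding for all small positive values of
    the infinitesimal hold together at some common value [d]. This lets a point determine its leaf
    region. *)
Lemma leaf_regions_inj (R : realType) (m : nat) (t : hyperplane_tree R m)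
    D Q Q' x :
  leaf_regions t D Q -> leaf_regions t D Q' -> Q x -> Q' x -> Q = Q'.
Proof.
have sides fs c : left_side fs c x -> ~ right_side fs c x.
  move=> xl xr; have [d [dl dr]] := @filter_ex _ (0 : R)^'+ _ _ (filterI xl xr).
  by rewrite /= leNgt dl in dr.
elim: t D => [|fs c l IHl r IHr] D /=; first by move=> -> ->.
move=> [tQ|tQ] [tQ'|tQ'] Qx Q'x.
- exact: IHl tQ tQ' Qx Q'x.
- case: (leaf_regions_sub tQ Qx) (leaf_regions_sub tQ' Q'x).
  by move=> _ /sides xr [].
- case: (leaf_regions_sub tQ Qx) (leaf_regions_sub tQ' Q'x).
  by move=> _ xr [_ /sides].
- exact: IHr tQ tQ' Qx Q'x.
Qed.

(** * Means, extrema and variance over finite sets *)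

Section FsetStatistics.
Variables (R : realType) (T : choiceType).
Implicit Types (A : {fset T}) (h : T -> R).

Lemma fmean_seq A (s : seq T) h : uniq s -> A =i s ->
  fmean A h = (\sum_(x <- s) h x) / (size s)%:R.
Proof.
move=> us As; have ps : perm_eq A s by apply: uniq_perm.
by rewrite /fmean (perm_big _ ps) /= (perm_size ps).
Qed.

Lemma fmin_le A h x : x \in A -> fmin A h <= h x.
Proof.
move=> xA; rewrite /fmin; set s := [seq h y | y <- A].
have : h x \in s by apply: map_f.
elim: s (head 0 s) => // a s IHs d.
rewrite inE big_cons ge_min => /orP[/eqP ->|/IHs ->]; first by rewrite lexx.
by rewrite orbT.
Qed.

(** The point [x] makes [A] nonempty, so that the default of the minimum is itself a value of [h] on
    [A]. *)
Lemma fmin_ge A h b x : x \in A -> (forall y, y \in A -> b <= h y) ->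
  b <= fmin A h.
Proof.
move=> xA bA; have hb : {in [seq h y | y <- A], forall v, b <= v}.
  by move=> _ /mapP[y yA ->]; apply: bA.
rewrite /fmin big_seq; apply: le_bigmin => //.
by case: [seq h y | y <- A] (map_f h xA) hb => //= a s _; apply; rewrite mem_head.
Qed.

Lemma fmaxE A h : fmax A h = - fmin A (fun x => - h x).
Proof.
rewrite /fmax /fmin (map_comp -%R h).
move: [seq h x | x <- A] => s.
have -> : head 0 [seq - i | i <- s] = - head 0 s by case: s => //=; rewrite oppr0.
rewrite big_map; elim: s (head 0 s) => [|a s IHs] d; rewrite ?big_nil ?opprK//.
by rewrite !big_cons oppr_min opprK IHs.
Qed.

Lemma fmax_ge A h x : x \in A -> h x <= fmax A h.
Proof. by move=> xA; rewrite fmaxE lerNr; apply: (@fmin_le A (fun x => - h x)). Qed.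

Lemma fmax_le A h b x : x \in A -> (forall y, y \in A -> h y <= b) ->
  fmax A h <= b.
Proof.
move=> xA bA; rewrite fmaxE lerNl; apply: (fmin_ge xA) => y yA.
by rewrite lerN2 bA.
Qed.

(** The variance is the mean of the squared deviations, and [h x] and [h y] cannot both equal the
    mean. *)
Lemma variance_gt0 A h x y : x \in A -> y \in A -> h x != h y ->
  0 < fmean A (fun z => h z ^+ 2) - fmean A h ^+ 2.
Proof.
move=> xA yA hxy; rewrite /fmean; set n : R := _%:R; set S := \sum_(x <- A) h x.
have n0 : 0 < n.
  by rewrite ltr0n lt0n cardfs_eq0; apply: contraTneq xA => ->; rewrite inE.
set mu := S / n.
have -> : (\sum_(x <- A) h x ^+ 2) / n - mu ^+ 2 =
    (\sum_(x <- A) (h x - mu) ^+ 2) / n.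
  under [in RHS]eq_bigr do rewrite sqrrB.
  rewrite !big_split /= sumrN big_const_seq iter_addr addr0 count_predT.
  under [X in _ - X + _]eq_bigr do rewrite -mulrnAl.
  rewrite -mulr_suml sumrMnl -/S -[mu ^+ 2 *+ _]mulr_natr -/n.
  have -> : S = mu * n by rewrite /mu divfK ?gt_eqF.
  by field; rewrite gt_eqF.
rewrite divr_gt0// lt0r psumr_neq0 ?sumr_ge0 ?andbT// => [|i _|i _];
  rewrite ?sqr_ge0//.
have [hx|hx] := eqVneq (h x) mu; apply/hasP.
  exists y => //=; rewrite exprn_even_gt0 //= subr_eq0 -hx eq_sym//.
by exists x => //=; rewrite exprn_even_gt0 //= subr_eq0.
Qed.

End FsetStatistics.

(** * Geometry of the bisection and of the displaced samples *)

Section Bisection.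
Variables (R : realType) (m : nat) (ax : nat -> 'I_m) (rho : R).
Hypothesis rho_gt0 : 0 < rho.
Local Notation V := 'rV[R]_m.
Local Notation "''e_' i" := (delta_mx 0 i : V) (at level 8, i at level 2).

(* A node is indexed by the number [s] of splits still to be made below it; it is
   split along the axis [ax s]. *)
Fixpoint halfwidth (s : nat) (l : 'I_m) : R :=
  if s is s'.+1 then
    if l == ax s then 2 * halfwidth s' l else halfwidth s' l
  else rho.

(** Bound on the mean displacement at level [s]. The ratio 4 absorbs a shift by [3 * amplitude s.+1]
    on top of an old entry of size at most [amplitude s.+1]. *)
Definition amplitude (s : nat) : R := rho / 4 ^+ s.+1.

Definition child_center (s : nat) (sg : R) (c : V) : V :=
  c + (sg * halfwidth s (ax s.+1)) *: 'e_(ax s.+1).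

(** The centre moves along the axis [ax s.+1] of the parent's split, but the displacement changes
    along [ax s], the axis on which the child itself is to be split. *)
Definition child_shift (s : nat) (sg : R) (v : V) : V :=
  v + (sg * (3 * amplitude s.+1)) *: 'e_(ax s).

(* [k = 1] gives the targets and [k = 0] the non-targets below a node of centre
   [c] whose cells have mean displacement [v]. *)
Fixpoint cell_points (k : R) (s : nat) (c v : V) : seq V :=
  if s is s'.+1 then
    cell_points k s' (child_center s' (-1) c) (child_shift s' (-1) v) ++
    cell_points k s' (child_center s' 1 c) (child_shift s' 1 v)
  else [:: c + k *: v].

(** The invariant of the induction: the first clause leaves room for the next shift, the second
    makes [ax s] the only selected feature, the third keeps [SDmax] nonzero. *)
Definition dominated (s : nat) (v : V) : Prop :=
  [/\ forall l, `|v 0 l| <= amplitude s,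
      forall l, l != ax s -> `|v 0 l| < `|v 0 (ax s)| &
      v 0 (ax s) != 0].

Lemma halfwidth_ge s l : rho <= halfwidth s l.
Proof. by elim: s => //= s IHs; case: ifP => // _; have := rho_gt0; lra. Qed.

Lemma amplitude_gt0 s : 0 < amplitude s.
Proof. by rewrite divr_gt0 ?exprn_gt0. Qed.

Lemma amplitudeS s : amplitude s = 4 * amplitude s.+1.
Proof.
by rewrite /amplitude [4 ^+ s.+2]exprS; field; rewrite expf_neq0// pnatr_eq0.
Qed.

Lemma amplitude_le s : amplitude s <= rho / 4.
Proof.
elim: s => [|s]; first by rewrite /amplitude expr1.
by have := amplitude_gt0 s.+1; rewrite [amplitude s]amplitudeS; lra.
Qed.

(** The opposite moves of centre and displacement in the two children cancel in the sum. *)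
Lemma sum_cell_points k s c v :
  \sum_(x <- cell_points k s c v) x = (2 ^ s)%:R *: (c + k *: v).
Proof.
elim: s c v => [|s IHs] c v /=; first by rewrite big_seq1 expn0 scale1r.
rewrite big_cat /= !IHs -scalerDr expnS natrM [2 * _]mulrC -scalerA; congr (_ *: _).
rewrite /child_center /child_shift !mulN1r !mul1r !scaleNr.
by apply/rowP => l; rewrite !mxE; ring.
Qed.

Lemma size_cell_points k s c v : size (cell_points k s c v) = (2 ^ s)%N.
Proof.
by elim: s c v => //= s IHs c v; rewrite size_cat !IHs addnn expnS mul2n.
Qed.

(** The sign is left free because the sign of [v 0 (ax s.+1)] decides which child becomes the right
    subtree. *)
Lemma mem_cell_points k s c v x sg : `|sg| = 1 ->
  (x \in cell_points k s.+1 c v) =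
  (x \in cell_points k s (child_center s sg c) (child_shift s sg v)) ||
  (x \in cell_points k s (child_center s (- sg) c) (child_shift s (- sg) v)).
Proof.
by move=> /eqP; rewrite eqr_norml => /andP[/orP[]/eqP-> _] /=;
  rewrite mem_cat ?opprK // orbC.
Qed.

(** With [a] the parent's amplitude, adding [3 * a] in absolute value to an entry of size at most
    [a] gives a size between [2 * a] and [4 * a], while all other entries stay at most [a]. *)
Lemma dominated_child s sg v : `|sg| = 1 -> dominated s.+1 v ->
  dominated s (child_shift s sg v).
Proof.
move=> sg1 [vs _ _]; set a := amplitude s.+1.
have a0 : 0 < a by apply: amplitude_gt0.
have aS : amplitude s = 4 * a by apply: amplitudeS.
have ax_sg : 2 * a <= `|child_shift s sg v 0 (ax s)| <= 4 * a.
  rewrite !mxE !eqxx mulr1 -/a.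
  move: sg1 => /eqP; rewrite eqr_norml => /andP[/orP[]/eqP-> _];
  by have := vs (ax s); rewrite -/a ler_norml => /andP[] *;
    rewrite ler_normr ler_norml; apply/andP; split;
    [apply/orP; ((left; lra) || (right; lra))|apply/andP; split; lra].
have other l : l != ax s -> `|child_shift s sg v 0 l| <= a.
  by move=> ls; rewrite !mxE (negPf ls) andbF mulr0 addr0 vs.
split.
- move=> l; rewrite aS; have [->|/other] := eqVneq l (ax s); last by lra.
  by case/andP: ax_sg.
- by move=> l /other; case/andP: ax_sg; lra.
- by rewrite -normr_gt0; case/andP: ax_sg; lra.
Qed.

Lemma child_center_ax s sg c :
  child_center s sg c 0 (ax s.+1) = c 0 (ax s.+1) + sg * halfwidth s (ax s.+1).
Proof. by rewrite !mxE !eqxx mulr1. Qed.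

Lemma child_center_other s sg c l : l != ax s.+1 ->
  child_center s sg c 0 l = c 0 l.
Proof. by move=> ls; rewrite !mxE (negPf ls) andbF mulr0 addr0. Qed.

Lemma sign_cases (sg : R) : `|sg| = 1 -> sg = 1 \/ sg = -1.
Proof. by move=> /eqP; rewrite eqr_norml => /andP[/orP[]/eqP-> _]; [left|right]. Qed.

(** Cell centres lie within [halfwidth s l - rho] of [c], and the displacement in a cell adds at
    most [rho / 4]. *)
Lemma cell_points_box k s c v x l : 0 <= k <= 1 -> dominated s v ->
  x \in cell_points k s c v ->
  `|x 0 l - c 0 l| <= halfwidth s l - rho + rho / 4.
Proof.
move=> k01; elim: s c v => [|s IHs] c v dv.
  rewrite /= inE => /eqP ->; rewrite !mxE addrAC subrr add0r subrr add0r normrM.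
  rewrite (ger0_norm (proj1 (andP k01))).
  case: dv => /(_ l) vl _ _; have := amplitude_le 0.
  by have := normr_ge0 (v 0 l); case/andP: k01; nra.
rewrite (mem_cell_points _ _ _ _ _ (normr1 R)) => xs.
have [sg sg1 {}xs] : exists2 sg, `|sg| = 1 &
    x \in cell_points k s (child_center s sg c) (child_shift s sg v).
  by case/orP: xs; [exists 1|exists (-1)]; rewrite ?normrN ?normr1.
have := IHs _ _ (dominated_child sg1 dv) xs.
rewrite /=; have [->|ls] := eqVneq l (ax s.+1); last by rewrite child_center_other.
rewrite child_center_ax; have := halfwidth_ge s (ax s.+1); have := rho_gt0.
by case: (sign_cases sg1) => ->; rewrite !ler_norml; lra.
Qed.

(** Descending always into the child on the side [sg] reaches an outermost cell in direction [l];
    the displacement there costs at most [rho / 4]. *)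
Lemma cell_points_extreme k s c v l sg : 0 <= k <= 1 -> `|sg| = 1 ->
  dominated s v ->
  exists2 x, x \in cell_points k s c v &
    halfwidth s l - rho - rho / 4 <= sg * (x 0 l - c 0 l).
Proof.
move=> k01 sg1; elim: s c v => [|s IHs] c v dv.
  exists (c + k *: v); rewrite ?mem_head//= !mxE.
  case: dv => /(_ l) + _ _; have := amplitude_le 0.
  rewrite ler_norml => a /andP[? ?]; case/andP: k01 => *.
  by case: (sign_cases sg1) => ->; nra.
have [x xs xc] := IHs (child_center s sg c) _ (dominated_child sg1 dv).
exists x; first by rewrite (mem_cell_points _ _ _ _ _ sg1) xs.
move: xc; rewrite /=; have [->|ls] := eqVneq l (ax s.+1).
  by rewrite child_center_ax; case: (sign_cases sg1) => ->; have := rho_gt0; lra.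
by rewrite child_center_other.
Qed.

(* The children are separated by the hyperplane through the centre [c] with a
   margin that exceeds the error [rho / 4] on the threshold. *)
Lemma child_side k s c v x sg : 0 <= k <= 1 -> `|sg| = 1 ->
  dominated s.+1 v ->
  x \in cell_points k s (child_center s sg c) (child_shift s sg v) ->
  3 / 4 * rho <= sg * (x 0 (ax s.+1) - c 0 (ax s.+1)).
Proof.
move=> k01 sg1 dv xs.
have := cell_points_box (ax s.+1) k01 (dominated_child sg1 dv) xs.
rewrite child_center_ax ler_norml.
by case: (sign_cases sg1) => -> /andP[]; lra.
Qed.

Lemma children_disjoint k k' s c v x : 0 <= k <= 1 -> 0 <= k' <= 1 ->
  dominated s.+1 v ->
  x \in cell_points k s (child_center s 1 c) (child_shift s 1 v) ->
  x \notin cell_points k' s (child_center s (-1) c) (child_shift s (-1) v).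
Proof.
move=> k01 k01' dv /(child_side k01 (normr1 R) dv) xs; apply/negP.
move=> /(child_side k01' (normrN1 R) dv); have := rho_gt0; lra.
Qed.

Lemma cell_points_uniq k s c v : 0 <= k <= 1 -> dominated s v ->
  uniq (cell_points k s c v).
Proof.
move=> k01; elim: s c v => //= s IHs c v dv.
rewrite cat_uniq !IHs ?andbT /=;
  try by apply: dominated_child dv; rewrite ?normrN ?normr1.
by apply/hasPn => x /(children_disjoint k01 k01 dv).
Qed.

Lemma targets_notin_nontargets s c v x : dominated s v ->
  x \in cell_points 1 s c v -> x \notin cell_points 0 s c v.
Proof.
have k0 : 0 <= (0 : R) <= 1 by rewrite lexx ler01.
have k1 : 0 <= (1 : R) <= 1 by rewrite lexx ler01.
elim: s c v => [|s IHs] c v dv /=.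
  rewrite !inE => /eqP ->; rewrite scale0r scale1r addr0; case: dv => _ _.
  apply: contra; rewrite -[X in _ == X]addr0 (inj_eq (addrI c)) => /eqP ->.
  by rewrite mxE.
have d1 := dominated_child (normr1 R) dv.
have d2 := dominated_child (normrN1 R) dv.
rewrite !mem_cat negb_or => /orP[xs|xs]; apply/andP; split; try exact: IHs xs.
  by apply: contraTN xs => /(children_disjoint k0 k1 dv).
exact: (children_disjoint k1 k0 dv).
Qed.

(** * The weights, threshold and splitting computed at a node *)

Definition node (s : nat) (c v : V) : {fset V} :=
  [fset x in cell_points 1 s c v ++ cell_points 0 s c v]%fset.

Lemma mem_node s c v x :
  (x \in node s c v) = (x \in cell_points 1 s c v) || (x \in cell_points 0 s c v).
Proof. by rewrite in_fset /= mem_cat. Qed.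

Variables (p : V -> bool) (q : lht_params R).
Hypotheses (alphaE : alpha q = 0) (betaE : beta q = 1)
  (min_countE : min_count q = 3%N).

Definition labelled (s : nat) (c v : V) : Prop :=
  {in cell_points 1 s c v, forall x, p x} /\
  {in cell_points 0 s c v, forall x, ~~ p x}.

Lemma labelled_child s sg c v : `|sg| = 1 -> labelled s.+1 c v ->
  labelled s (child_center s sg c) (child_shift s sg v).
Proof.
move=> sg1 [p1 p0]; split=> x xs; [apply: p1|apply: p0];
by rewrite (mem_cell_points _ _ _ _ _ sg1) xs.
Qed.

Let k0 : 0 <= (0 : R) <= 1. Proof. by rewrite lexx ler01. Qed.
Let k1 : 0 <= (1 : R) <= 1. Proof. by rewrite lexx ler01. Qed.

Lemma targets_node s c v : labelled s c v ->
  targets p (node s c v) =i cell_points 1 s c v.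
Proof.
move=> [p1 p0] x; rewrite !inE /=.
have [/p1 ->//|_] := boolP (x \in cell_points 1 s c v).
by case: (boolP (x \in _)) => //= /p0 /negPf.
Qed.

Lemma nontargets_node s c v : labelled s c v ->
  nontargets p (node s c v) =i cell_points 0 s c v.
Proof.
move=> [p1 p0] x; rewrite !inE /=.
have [/p0 ->|_] := boolP (x \in cell_points 0 s c v); first by rewrite orbT.
by case: (boolP (x \in _)) => //= /p1 ->.
Qed.

Lemma mean_cell_points k s c v l :
  (\sum_(x <- cell_points k s c v) x 0 l) / (size (cell_points k s c v))%:R =
  c 0 l + k * v 0 l.
Proof.
by rewrite -summxE sum_cell_points size_cell_points !mxE mulrC mulKf//.
Qed.

Lemma SD_node s c v l : dominated s v -> labelled s c v ->
  SD p (node s c v) l = v 0 l.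
Proof.
move=> dv lv; rewrite /SD.
rewrite (fmean_seq _ (cell_points_uniq c k1 dv) (targets_node lv)).
rewrite (fmean_seq _ (cell_points_uniq c k0 dv) (nontargets_node lv)).
by rewrite !mean_cell_points; ring.
Qed.

Lemma card_node s c v : dominated s v -> #|` node s c v| = (2 ^ s.+1)%N.
Proof.
move=> dv; rewrite card_fseq undup_id; last first.
  rewrite cat_uniq !cell_points_uniq// andbT; apply/hasPn => x x0.
  by apply: contraTN x0 => /(targets_notin_nontargets dv).
by rewrite size_cat !size_cell_points addnn expnS mul2n.
Qed.

Lemma retained_node s c v : dominated s v -> labelled s c v ->
  retained q (node s c v) (ax s).
Proof.
move=> dv lv; rewrite /retained alphaE.
have ptX k x : k \in [:: 0; 1] -> x \in cell_points k s c v -> x \in node s c v.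
  by rewrite mem_node !inE => /orP[]/eqP-> ->; rewrite ?orbT.
pose h (x : V) := x 0 (ax s).
have [a aX [b bX hab]] : exists2 a, a \in node s c v &
    exists2 b, b \in node s c v & h a != h b.
  (* If all samples agreed in the coordinate [ax s], so would the means of targets and non-targets,
     whose difference is the nonzero [v 0 (ax s)]. *)
  apply: contrapT => hc.
  have [a0 a0X _] := cell_points_extreme c (ax s) k0 (normr1 R) dv.
  have hE k x : k \in [:: 0; 1] -> x \in cell_points k s c v -> h x = h a0.
    move=> kk xk; apply/eqP/negPn/negP => hx; apply: hc.
    exists x; first exact: ptX xk.
    by exists a0 => //; apply: ptX a0X; rewrite !inE eqxx.
  have mE k : k \in [:: 0; 1] -> c 0 (ax s) + k * v 0 (ax s) = h a0.
    move=> kk; rewrite -(mean_cell_points k s) big_seq.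
    rewrite (eq_bigr (fun=> h a0)) => [|x xk]; last exact: hE xk.
    rewrite -big_seq big_const_seq iter_addr addr0 count_predT.
    rewrite -[h a0 *+ _]mulr_natr mulfK//.
    by rewrite pnatr_eq0 size_cell_points expn_eq0.
  case: dv => _ _ /eqP; apply.
  have := mE 0; have := mE 1; rewrite !inE !eqxx ?orbT => /(_ isT) + /(_ isT).
  by lra.
exact: (@variance_gt0 _ _ _ h a b).
Qed.

Lemma SDmax_node s c v : dominated s v -> labelled s c v ->
  SDmax q p (node s c v) = `|v 0 (ax s)|.
Proof.
move=> dv lv; rewrite /SDmax.
under eq_bigr do rewrite SD_node//.
have vl l : `|v 0 l| <= `|v 0 (ax s)|.
  by have [->//|/(let: And3 _ d _ := dv in d)/ltW] := eqVneq l (ax s).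
apply/le_anti/andP; split; first by apply: bigmax_le => [|i _]; rewrite ?vl.
exact: (le_bigmax_cond 0 (fun l => `|v 0 l|) (retained_node dv lv)).
Qed.

(* Since [beta q = 1], only the feature of maximal [`|SD|] is selected. *)
Lemma FS_node s c v x : dominated s v -> labelled s c v ->
  FS q p (node s c v) x = Num.sg (v 0 (ax s)) * x 0 (ax s).
Proof.
move=> dv lv.
have v0 : v 0 (ax s) != 0 by case: dv.
have wE l : weight q p (node s c v) l = v 0 l / `|v 0 (ax s)|.
  by rewrite /weight SD_node// SDmax_node.
rewrite /FS (big_pred1 (ax s)) => [|l].
  by rewrite wE {1}[v 0 _]numEsg mulfK// normr_eq0.
rewrite /selected betaE wE normrM normfV normr_id ler_pdivlMr ?normr_gt0// mul1r.
rewrite /=; have [->|ls] := eqVneq l (ax s); first by rewrite retained_node ?lexx.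
by rewrite lt_geF ?andbF//; case: dv => _ /(_ _ ls).
Qed.

(** Each extremum is bounded on one side by [cell_points_box] and on the other by an outermost
    point. The two estimates are symmetric about [sg * c 0 (ax s)]. *)
Lemma extrema_cell_points (A : {fset V}) k s c v fs sg :
  0 <= k <= 1 -> `|sg| = 1 -> dominated s v -> A =i cell_points k s c v ->
  fs =1 (fun x : V => sg * x 0 (ax s)) ->
  `|fmin A fs - (sg * c 0 (ax s) - (halfwidth s (ax s) - rho))| <= rho / 4 /\
  `|fmax A fs - (sg * c 0 (ax s) + (halfwidth s (ax s) - rho))| <= rho / 4.
Proof.
move=> kk sg1 dv Ak fsE.
have [a aA ea] := cell_points_extreme c (ax s) kk sg1 dv.
have sgN1 : `|- sg| = 1 by rewrite normrN.
have [b bA eb] := cell_points_extreme c (ax s) kk sgN1 dv.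
rewrite -Ak in aA; rewrite -Ak in bA.
have box x : x \in A -> `|fs x - sg * c 0 (ax s)| <=
    halfwidth s (ax s) - rho + rho / 4.
  rewrite Ak fsE -mulrBr normrM sg1 mul1r; exact: cell_points_box.
have {}ea : halfwidth s (ax s) - rho - rho / 4 <= fs a - sg * c 0 (ax s).
  by rewrite fsE; lra.
have {}eb : fs b - sg * c 0 (ax s) <= - (halfwidth s (ax s) - rho - rho / 4).
  by rewrite fsE; lra.
have minb := fmin_le fs bA; have maxa := fmax_ge fs aA.
have ming : sg * c 0 (ax s) - (halfwidth s (ax s) - rho + rho / 4) <= fmin A fs.
  by apply: (fmin_ge aA) => y /box; rewrite ler_norml; lra.
have maxl : fmax A fs <= sg * c 0 (ax s) + (halfwidth s (ax s) - rho + rho / 4).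
  by apply: (fmax_le aA) => y /box; rewrite ler_norml; lra.
by rewrite !ler_norml; split; apply/andP; split; lra.
Qed.

(** Each count concerns a subset of the [2 ^ s] targets or non-targets, so it stays below [gamma q]
    and the threshold is the average of the extrema. There the terms [halfwidth s (ax s) - rho]
    cancel and the errors average to at most [rho / 4]. *)
Lemma threshold_node s c v : dominated s v -> labelled s c v ->
  (2 ^ s)%:R < gamma q ->
  exists2 e, is_threshold q p (node s c v) (fun=> e) &
    `|e - Num.sg (v 0 (ax s)) * c 0 (ax s)| <= rho / 4.
Proof.
move=> dv lv gam.
have v0 : v 0 (ax s) != 0 by case: dv.
have sg1 : `|Num.sg (v 0 (ax s))| = 1 by rewrite normr_sg v0.
have fsE x := FS_node x dv lv.
have [minT maxT] := extrema_cell_points k1 sg1 dv (targets_node lv) fsE.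
have [minN maxN] := extrema_cell_points k0 sg1 dv (nontargets_node lv) fsE.
set X := node s c v in fsE minT maxT minN maxN *.
set fs := FS q p X in fsE minT maxT minN maxN *.
exists ((fmin (targets p X) fs + fmax (targets p X) fs +
         fmin (nontargets p X) fs + fmax (nontargets p X) fs) / 4); last first.
  by move: minT maxT minN maxN; rewrite !ler_norml; lra.
rewrite /is_threshold -/fs.
have small (A : {fset V}) (P : pred V) k : A =i cell_points k s c v ->
    (#|` [fset x in A | P x]%fset| <= 2 ^ s)%N.
  move=> Ak; apply: (@leq_trans (#|` A|)).
    by apply: fsubset_leq_card; apply/fsubsetP => x; rewrite !inE => /andP[].
  rewrite -(size_cell_points k s c v); apply: uniq_leq_size => // x.
  by rewrite Ak.
case: ifP => // /(lt_le_trans gam); rewrite ltr_nat ltnNge.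
by rewrite !geq_max !(small _ _ _ (targets_node lv))
  !(small _ _ _ (nontargets_node lv)).
Qed.

Lemma leaf_node0 c v : dominated 0 v -> is_leaf_node q p (node 0 c v).
Proof. by move=> dv; rewrite /is_leaf_node card_node// min_countE orbT. Qed.

Lemma branch_nodeS s c v : dominated s.+1 v -> labelled s.+1 c v ->
  ~~ is_leaf_node q p (node s.+1 c v).
Proof.
move=> dv [p1 p0]; rewrite /is_leaf_node card_node// min_countE negb_or.
(* At level [s.+1] there are at least four samples, and both labels occur. *)
apply/andP; split; last by rewrite -leqNgt (@leq_trans (2 ^ 2))// leq_exp2l.
have [a a1 _] := cell_points_extreme c (ax s) k1 (normr1 R) dv.
have [b b0 _] := cell_points_extreme c (ax s) k0 (normr1 R) dv.
have aX : a \in node s.+1 c v by rewrite mem_node a1.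
have bX : b \in node s.+1 c v by rewrite mem_node b0 orbT.
apply/negP => /(constantP false)[l El].
have pl x : x \in node s.+1 c v -> p x = l.
  by move=> /(map_f p); rewrite El mem_nseq => /andP[_ /eqP].
by move: (p1 _ a1) (p0 _ b0); rewrite !pl// => ->.
Qed.

(** [P] stands for either side of the split. Only its values at distance at least [3 / 4 * rho] from
    the central hyperplane matter, since [child_side] keeps every sample that far away. *)
Lemma node_child s (c v : V) (sg : R) (P : V -> Prop) : `|sg| = 1 ->
  dominated s.+1 v ->
  (forall x : V, 3 / 4 * rho <= sg * (x 0 (ax s.+1) - c 0 (ax s.+1)) -> P x) ->
  (forall x : V, 3 / 4 * rho <= - sg * (x 0 (ax s.+1) - c 0 (ax s.+1)) -> ~ P x) ->
  [fset x in node s.+1 c v | `[< P x >]]%fset =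
  node s (child_center s sg c) (child_shift s sg v).
Proof.
move=> sg1 dv Pyes Pno; apply/fsetP => x.
rewrite (_ : (x \in _) = (x \in node s.+1 c v) && `[< P x >]); last by rewrite !inE.
rewrite !mem_node !(mem_cell_points _ _ _ _ _ sg1).
have sgN1 : `|- sg| = 1 by rewrite normrN.
have yes k : 0 <= k <= 1 ->
    x \in cell_points k s (child_center s sg c) (child_shift s sg v) ->
    `[< P x >].
  by move=> kk /(child_side kk sg1 dv) /Pyes /asboolP.
have no k : 0 <= k <= 1 ->
    x \in cell_points k s (child_center s (- sg) c) (child_shift s (- sg) v) ->
    `[< P x >] = false.
  by move=> kk /(child_side kk sgN1 dv) /Pno /asboolPn /negPf.
move: (yes _ k1) (yes _ k0) (no _ k1) (no _ k0).
by do 4!case: (x \in _); case: `[< P x >] => //=;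
  first [move=> /(_ isT) | move=> _ /(_ isT) | move=> _ _ /(_ isT) |
         move=> _ _ _ /(_ isT)].
Qed.

(** * Construction of the tree and diameter of its leaf regions *)

Definition in_box (s : nat) (c x : V) : Prop :=
  forall l, `|x 0 l - c 0 l| <= halfwidth s l + rho / 4.

(** The slack [rho / 4] does not accumulate: the new face is off by the error of a single threshold,
    and the other faces are inherited unchanged. *)
Lemma in_box_child s sg c x : `|sg| = 1 -> in_box s.+1 c x ->
  - (rho / 4) <= sg * (x 0 (ax s.+1) - c 0 (ax s.+1)) ->
  in_box s (child_center s sg c) x.
Proof.
move=> sg1 xc xs l; have := xc l; rewrite /=.
have [->|ls] := eqVneq l (ax s.+1); last by rewrite child_center_other.
rewrite child_center_ax; have := halfwidth_ge s (ax s.+1); have := rho_gt0.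
by move: xs; case: (sign_cases sg1) => ->; rewrite !ler_norml; lra.
Qed.

(** The diameter bound is restricted to the box because outer leaf regions may be unbounded; [D] is
    arbitrary so that the induction passes to subtrees. *)
Lemma node_tree s c v : dominated s v -> labelled s c v ->
  (2 ^ s)%:R < gamma q ->
  exists t, [/\ is_LHT q p (node s c v) t,
    forall (D : set V) x, D x -> exists2 Q, leaf_regions t D Q & Q x &
    forall D Q x y, leaf_regions t D Q -> Q x -> Q y ->
      in_box s c x -> in_box s c y ->
      forall l, `|x 0 l - y 0 l| <= 5 / 2 * rho].
Proof.
elim: s c v => [|s IHs] c v dv lv gam.
  exists Leaf; split; first exact/LHT_leaf/leaf_node0.
    by move=> D x Dx; exists D.
  (* A final cell with its slack has side [2 * (rho + rho / 4)]. *)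
  move=> D Q x y _ _ _ xc yc l; have := xc l; have := yc l.
  by rewrite /= !ler_norml; lra.
have [e te] := threshold_node dv lv gam.
set i := ax s.+1; set sg := Num.sg (v 0 i); rewrite ler_norml => ec.
have sg1 : `|sg| = 1 by rewrite normr_sg; case: dv => _ _ ->.
have sgN1 : `|- sg| = 1 by rewrite normrN.
set fs := FS q p (node s.+1 c v) in te.
have fsE x : fs x = sg * x 0 i by apply: FS_node.
have leftE x : left_side fs (fun=> e) x <-> sg * x 0 i < e.
  rewrite /left_side /= fsE subr_lt0; split=> [xe|?]; last exact: nearW.
  by have [] := @filter_ex _ (0 : R)^'+ _ _ xe.
have rightE x : right_side fs (fun=> e) x <-> e <= sg * x 0 i.
  rewrite /right_side /= fsE subr_ge0; split=> [xe|?]; last exact: nearW.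
  by have [] := @filter_ex _ (0 : R)^'+ _ _ xe.
have gam' : (2 ^ s)%:R < gamma q.
  by apply: le_lt_trans gam; rewrite ler_nat leq_exp2l.
(* Since [fs x = sg * x 0 i], the smaller values of [fs] lie on the side [- sg], which therefore is
   the left subtree. *)
have [l [lt lc ld]] := IHs (child_center s (- sg) c) _
  (dominated_child sgN1 dv) (labelled_child sgN1 lv) gam'.
have [r [rt rc rd]] := IHs (child_center s sg c) _
  (dominated_child sg1 dv) (labelled_child sg1 lv) gam'.
have r0 := rho_gt0.
exists (Branch fs (fun=> e) l r); split.
- apply: LHT_branch => //.
  + exact: branch_nodeS.
  + by rewrite SDmax_node// normr_eq0; case: dv.
  + rewrite (node_child sgN1)// => x; rewrite ?opprK -/i => xi.
      by apply/leftE; lra.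
    by move/leftE; lra.
  + rewrite (node_child sg1)// => x; rewrite -/i => xi.
      by apply/rightE; lra.
    by move/rightE; lra.
- move=> D x Dx; have [xe|xe] := ltP (sg * x 0 i) e.
    have [|Q lQ Qx] := lc (D `&` left_side fs (fun=> e)) x.
      by split=> //; apply/leftE.
    by exists Q => //; left.
  have [|Q rQ Qx] := rc (D `&` right_side fs (fun=> e)) x.
    by split=> //; apply/rightE.
  by exists Q => //; right.
- move=> D Q x y [lQ|rQ] Qx Qy xc yc.
    apply: (ld _ _ _ _ lQ Qx Qy); apply: in_box_child => //; rewrite -/i.
      by have [_ /leftE] := leaf_regions_sub lQ Qx; lra.
    by have [_ /leftE] := leaf_regions_sub lQ Qy; lra.
  apply: (rd _ _ _ _ rQ Qx Qy); apply: in_box_child => //; rewrite -/i.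
    by have [_ /rightE] := leaf_regions_sub rQ Qx; lra.
  by have [_ /rightE] := leaf_regions_sub rQ Qy; lra.
Qed.

End Bisection.

(** * Cyclic choice of axes and existence of fine trees *)

Section CyclicAxes.
Variables (R : realType) (m : nat) (rho : R).
Hypothesis rho_gt0 : 0 < rho.

Definition cyclic_axis (s : nat) : 'I_m.+1 := inord (s.-1 %% m.+1).

Lemma halfwidth_mono s t l : (s <= t)%N ->
  halfwidth cyclic_axis rho s l <= halfwidth cyclic_axis rho t l.
Proof.
elim: t => [|t IHt]; first by rewrite leqn0 => /eqP ->.
rewrite leq_eqVlt => /orP[/eqP ->//|]; rewrite ltnS => /IHt /le_trans -> //=.
have := halfwidth_ge cyclic_axis rho_gt0 t l; have := rho_gt0.
by case: ifP => _; lra.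
Qed.

Lemma halfwidth_cyclic k l :
  2 ^+ k * rho <= halfwidth cyclic_axis rho (k * m.+1) l.
Proof.
elim: k => [|k IHk]; first by rewrite mul1r.
(* Within the block of [m.+1] levels after [k * m.+1], the level [(k * m.+1 + l).+1] is the one that
   doubles coordinate [l]. *)
have lt_l : ((k * m.+1 + l).+1 <= k.+1 * m.+1)%N.
  by rewrite -addnS mulSn addnC leq_add2r.
apply: le_trans (halfwidth_mono l lt_l) => /=.
rewrite /cyclic_axis /= modnMDl modn_small// inord_val eqxx exprS -mulrA.
rewrite ler_pM2l//; apply: le_trans IHk _.
by apply: halfwidth_mono; apply: leq_addr.
Qed.

End CyclicAxes.

Lemma fine_tree (R : realType) (m : nat) (B delta : R) : 0 < delta ->
  exists (q : lht_params R) (X : {fset 'rV[R]_m}) (p : 'rV[R]_m -> bool)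
         (t : hyperplane_tree R m),
  [/\ is_LHT q p X t,
      forall x, exists2 Q, leaf_regions t setT Q & Q x &
      forall Q x y, leaf_regions t setT Q -> Q x -> Q y ->
        (forall l, `|x 0 l| <= B) -> (forall l, `|y 0 l| <= B) ->
        forall l, `|x 0 l - y 0 l| <= delta].
Proof.
(* In dimension zero there is no axis to split; the empty sample set yields a single leaf. *)
move=> d0; case: m => [|m].
  have b01 : 0 <= (1 : R) <= 1 by rewrite lexx ler01.
  exists (LhtParams 1 (lexx 0) b01 ltr01), fset0, xpredT, Leaf; split.
  - by apply: LHT_leaf; rewrite /is_leaf_node cardfs0 orbT.
  - by move=> x; exists setT.
  - by move=> Q x y _ _ _ _ _ [].
pose rho := delta * (2 / 5).
have r0 : 0 < rho by rewrite /rho; lra.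
(* From [|B| / rho < k < 2 ^ k], doubling every axis [k] times makes the root box contain the cube
   of half-width [B]. *)
pose k := Num.bound (`|B| / rho).
have kB : B <= 2 ^+ k * rho.
  rewrite -ler_pdivrMr//; apply: le_trans (_ : `|B| / rho <= _).
    by rewrite ler_pM2r ?invr_gt0// ler_norm.
  apply: le_trans (ltW (archi_boundP _)) _; first by rewrite divr_ge0// ltW.
  by rewrite -natrX ler_nat ltnW// ltn_expl.
pose ax := @cyclic_axis m; pose S := (k * m.+1)%N.
pose v : 'rV[R]_m.+1 := amplitude rho S *: delta_mx 0 (ax S).
have a0 : 0 < amplitude rho S by apply: amplitude_gt0.
have dv : dominated ax rho S v.
  have vax : v 0 (ax S) = amplitude rho S by rewrite !mxE !eqxx mulr1.
  have vo l : l != ax S -> v 0 l = 0.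
    by move=> ls; rewrite !mxE (negPf ls) andbF mulr0.
  split=> [l|l ls|]; rewrite ?vax ?gt_eqF//;
    last by rewrite vo// normr0 normr_gt0 gt_eqF.
  have [->|ls] := eqVneq l (ax S); first by rewrite vax gtr0_norm.
  by rewrite vo// normr0 ltW.
have b11 : 0 <= (1 : R) <= 1 by rewrite lexx ler01.
(* The root has [2 ^ S] targets and as many non-targets, so this [gamma] exceeds every count in the
   tree. *)
have gam0 : 0 < (2 ^ S).+1%:R :> R by rewrite ltr0n.
pose q := LhtParams 3 (lexx (0 : R)) b11 gam0.
pose p x := x \in cell_points ax rho 1 S 0 v.
have lv : labelled ax rho p S 0 v.
  split=> x // x0; apply: contraTN x0; exact: targets_notin_nontargets.
have gamS : (2 ^ S)%:R < gamma q by rewrite /= ltr_nat.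
have [t [tq tc td]] := node_tree r0 (erefl : alpha q = 0)
  (erefl : beta q = 1) (erefl : min_count q = 3%N) dv lv gamS.
exists q, (node ax rho S 0 v), p, t; split=> // [x|Q x y tQ Qx Qy xB yB].
  exact: tc.
have box (z : 'rV[R]_m.+1) : (forall l, `|z 0 l| <= B) -> in_box ax rho S 0 z.
  move=> zB l; rewrite mxE subr0; apply: le_trans (zB l) _.
  by apply: (le_trans kB); have := halfwidth_cyclic r0 k l; lra.
have -> : delta = 5 / 2 * rho by rewrite /rho; lra.
exact: td tQ Qx Qy (box _ xB) (box _ yB).
Qed.

(** * Consequences of compactness, and the approximation *)

Lemma compact_coord_bounded (R : realType) (m : nat) (K : set 'rV[R]_m) :
  compact K -> exists B : R, forall x, K x -> forall l, `|x 0 l| <= B.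
Proof.
move=> /compact_near_coveringP cK.
have : \forall B \near +oo, K `<=` (fun x => forall l, `|x 0 l| <= B).
  apply: cK => x Kx.
  pose M := \sum_(l < m) `|x 0 l|.
  near=> y B => l.
  have xM : `|x 0 l| <= M.
    by rewrite /M (bigD1 l)//= lerDl sumr_ge0.
  have MB : M + 1 <= B by near: B; apply: nbhs_pinfty_ge; rewrite num_real.
  have : ball x 1 y by near: y; apply: nbhsx_ballx.
  move=> [_ /(_ 0 l)]; rewrite /ball /= => xy.
  have := ler_distD (x 0 l) (y 0 l) 0; rewrite !subr0 distrC; lra.
move=> nB; have [B KB] := @filter_ex _ (+oo : set_system R) _ _ nB.
by exists B => x /KB.
Unshelve. all: by end_near.
Qed.

(** Continuity at [x] gives a radius [r] for [eps / 2]. Points [x'] within [r / 2] of [x], and [y]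
    within [d < r / 2] of [x'], are both in that ball, so one [d] serves a neighbourhood of [x];
    compactness then makes [d] uniform. *)
Lemma compact_uniformly_continuous (R : realType) (m : nat)
    (K : set 'rV[R]_m) (g : 'rV[R]_m -> R) (eps : R) :
  compact K -> {within K, continuous g} -> 0 < eps ->
  exists2 delta, 0 < delta & forall x y, K x -> K y ->
    (forall l, `|x 0 l - y 0 l| <= delta) -> `|g x - g y| < eps.
Proof.
move=> /compact_near_coveringP cK /subspace_continuousP cg e0.
pose P (d : R) (x : 'rV[R]_m) :=
  forall y, K x -> K y -> (forall l, `|x 0 l - y 0 l| <= d) -> `|g x - g y| < eps.
have : \forall d \near 0^'+, K `<=` P d.
  apply: cK => x Kx.
  have /cvgrPdist_lt /(_ (eps / 2)) := cg x Kx.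
  rewrite divr_gt0// => /(_ isT) /nbhs_ballP[r /= r0 xr].
  have r2 : 0 < r / 2 by rewrite divr_gt0.
  near=> x' d => y Kx' Ky x'y.
  have xx' : ball x (r / 2) x' by near: x'; apply: nbhsx_ballx.
  have dr : d < r / 2 by near: d; apply: nbhs_right_lt.
  have gx' : `|g x - g x'| < eps / 2.
    by apply: xr => //; apply: (le_ball _ xx'); have := r0; lra.
  have gy : `|g x - g y| < eps / 2.
    case: xx' => _ xx'; apply: xr => //; split=> // i l.
    have := xx' i l; have := x'y l.
    rewrite !ord1 /ball /=.
    by have := ler_distD (x' 0 l) (x 0 l) (y 0 l); move: dr; lra.
  by have := ler_distD (g x) (g x') (g y); rewrite (distrC (g x') (g x)); lra.
move=> nP; have [d [d0 dP]] :=
  @filter_ex _ (0 : R)^'+ _ _ (filterI (nbhs_right_gt 0) nP).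
by exists d => // x y Kx; apply: dP.
Unshelve. all: by end_near.
Qed.

Lemma constant_fit (R : realType) (m : nat) (g : 'rV[R]_m -> R) x :
  least_squares_fit [fset x]%fset g 0 (g x).
Proof.
move=> a' b'; rewrite !big_seq_fset1 /affine big1 => [|i _];
  last by rewrite mxE mul0r.
by rewrite add0r subrr expr0n /= sqr_ge0.
Qed.

Theorem theorem3 (R : realType) (m : nat) (K : set 'rV[R]_m)
    (g : 'rV[R]_m -> R) (hK : compact K) (hg : {within K, continuous g})
    (hg01 : forall x, K x -> 0 <= g x <= 1) (eps : R) (heps : 0 < eps) :
  exists f : 'rV[R]_m -> R,
    [/\ LHT_defined K g f,
        (forall x, K x -> 0 <= f x <= 1) &
        (ereal_sup [set `|f x - g x|%:E | x in K] < eps%:E)%E].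
Proof.
(* A pointwise bound only passes to the supremum as a weak inequality; [eps / 2] keeps the final one
   strict. *)
have e2 : 0 < eps / 2 by rewrite divr_gt0.
have [delta d0 gd] := compact_uniformly_continuous hK hg e2.
have [B KB] := compact_coord_bounded hK.
have [q [X [p [t [tX tc td]]]]] := fine_tree m B d0.
pose b (Q : set 'rV[R]_m) := g (get (Q `&` K)).
pose region x := get (leaf_regions t setT `&` [set Q | Q x]).
have regionE Q x : leaf_regions t setT Q -> Q x -> region x = Q.
  move=> tQ Qx.
  have [tx xx] : (leaf_regions t setT `&` [set Q | Q x]) (region x).
    by apply: (@getI _ _ Q).
  exact: leaf_regions_inj tx tQ xx Qx.
exists (fun x => Num.max 0 (Num.min (b (region x)) 1)).
split.
- exists q, X, p, t, (fun=> 0), b; split=> // Q tQ; split; last first.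
    move=> x [Qx _]; rewrite (regionE _ _ tQ Qx) /affine big1 ?add0r// => i _.
    by rewrite mxE mul0r.
  (* In a region that misses [K] no point can be selected, and every affine function fits the empty
     set. *)
  have [QK|/set0P/negP/negPn/eqP QK] := pselect (Q `&` K !=set0); last first.
    exists fset0; split; first by move=> x.
      by rewrite QK => -[].
    by move=> a' b'; rewrite !big_seq_fset0.
  exists [fset (get (Q `&` K))]%fset; split.
  + by move=> x /=; rewrite inE => /eqP ->; case: QK => z /getI.
  + by move=> _; apply/fset0Pn; exists (get (Q `&` K)); rewrite inE.
  + exact: constant_fit.
- by move=> x _; rewrite le_max lexx ge_max ler01 ge_min lexx orbT.
- apply: (@le_lt_trans _ _ (eps / 2)%:E); last by rewrite lte_fin; lra.
  apply: ge_ereal_sup => _ [x Kx <-]; rewrite lee_fin.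
  have [Q tQ Qx] := tc x; rewrite (regionE _ _ tQ Qx).
  have [Qz Kz] : (Q `&` K) (get (Q `&` K)) by apply: (@getI _ _ x).
  (* The fitted constant is a value of [g] on [K], so clipping to the unit interval leaves it
     unchanged. *)
  have /andP[b0 b1] := hg01 _ Kz.
  rewrite /b (min_idPl b1) (max_idPr b0) ltW// gd// => l.
  exact: td tQ Qz Qx (KB _ Kz) (KB _ Kx) l.
Qed.
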